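(* Let $N$ be a strict fuzzy negation, let $\mathcal{GO}$ be a bivariate general overlap function such that for all $x,y\in[0,1]$, $\mathcal{GO}(x,y)=0$ implies $xy=0$, and $\mathcal{GO}(x,y)=1$ implies $xy=1$. Let $G$ be the grouping function defined by $G(x,y)=N(\mathcal{GO}(N(x),N(y)))$. Then $I_{\mathcal{GO}}^{N}=I_{G,N^{-1}}$, where $I_{\mathcal{GO}}^{N}(x,y)=N(\mathcal{GO}(x,N(y)))$ and $I_{G,N^{-1}}(x,y)=G(N^{-1}(x),y)$ for all $x,y\in[0,1]$.
   Context: A fuzzy negation is a map $N:[0,1]\to[0,1]$ with $N(0)=1$, $N(1)=0$ and $N(x)\le N(y)$ whenever $y\le x$. It is strict if it is continuous and $N(x)<N(y)$ whenever $y<x$ (so $N$ is a bijection of $[0,1]$ with inverse $N^{-1}$). A bivariate general overlap function is a function $\mathcal{GO}:[0,1]^2\to[0,1]$ such that for all $x,y\in[0,1]$: (1) $\mathcal{GO}(x,y)=\mathcal{GO}(y,x)$; (2) if $xy=0$ then $\mathcal{GO}(x,y)=0$; (3) if $xy=1$ then $\mathcal{GO}(x,y)=1$; (4) $\mathcal{GO}$ is increasing (in the non-strict sense) in each variable; (5) $\mathcal{GO}$ is continuous. A grouping function is a function $G:[0,1]^2\to[0,1]$ that is commutative, continuous, increasing (in the non-strict sense) in each variable, and satisfies $G(x,y)=0$ if and only if $x=y=0$, and $G(x,y)=1$ if and only if $x=1$ or $y=1$. (The function $G$ in the claim is a grouping function.) *)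

(* Defs.v *)
From HB Require Import structures.
From mathcomp Require Import all_boot all_order all_algebra.
From mathcomp Require Import all_classical all_reals all_analysis.

Set Implicit Arguments.
Unset Strict Implicit.
Unset Printing Implicit Defensive.

Import Order.TTheory GRing.Theory Num.Theory.
Import numFieldNormedType.Exports.

Local Open Scope classical_set_scope.
Local Open Scope ring_scope.

Definition itv01 (R : realType) : set R := `[0, 1]%classic.
Arguments itv01 : clear implicits.

(* [0, 1] as a type: continuity below refers to the subtype topology of
   [set_type] and to its product topology on [0, 1]^2. *)
Notation unit_itv R := (set_type (itv01 R)).

Lemma zero_in_itv01 (R : realType) : (0 : R) \in itv01 R.
Proof. by rewrite inE /itv01 /= in_itv /= lexx ler01. Qed.

Lemma one_in_itv01 (R : realType) : (1 : R) \in itv01 R.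
Proof. by rewrite inE /itv01 /= in_itv /= ler01 lexx. Qed.

Definition I0 {R : realType} : unit_itv R := SigSub (zero_in_itv01 R).
Definition I1 {R : realType} : unit_itv R := SigSub (one_in_itv01 R).

Definition ival {R : realType} (x : unit_itv R) : R := set_val x.

Record fuzzy_negation (R : realType) (N : unit_itv R -> unit_itv R) : Prop := {
  fneg0 : N I0 = I1;
  fneg1 : N I1 = I0;
  fneg_anti : forall x y, ival y <= ival x -> ival (N x) <= ival (N y) }.

Record strict_fuzzy_negation (R : realType) (N : unit_itv R -> unit_itv R)
    : Prop := {
  sneg_fuzzy : fuzzy_negation N;
  sneg_cont : continuous N;
  sneg_lt : forall x y, ival y < ival x -> ival (N x) < ival (N y) }.

(* The inverse of N on its range; the default value [id] is never used when N
   is surjective, in particular when N is a strict fuzzy negation. *)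
Definition neg_inv (R : realType) (N : unit_itv R -> unit_itv R)
    : unit_itv R -> unit_itv R :=
  'pinv_id setT N.

Definition increasing2 (R : realType)
    (F : unit_itv R -> unit_itv R -> unit_itv R) : Prop :=
  (forall x x' y, ival x <= ival x' -> ival (F x y) <= ival (F x' y)) /\
  (forall x y y', ival y <= ival y' -> ival (F x y) <= ival (F x y')).

Definition continuous2 (R : realType)
    (F : unit_itv R -> unit_itv R -> unit_itv R) : Prop :=
  continuous (fun p : unit_itv R * unit_itv R => F p.1 p.2).

Record general_overlap (R : realType)
    (GO : unit_itv R -> unit_itv R -> unit_itv R) : Prop := {
  goC : forall x y, GO x y = GO y x;
  go0 : forall x y, ival x * ival y = 0 -> GO x y = I0;
  go1 : forall x y, ival x * ival y = 1 -> GO x y = I1;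
  go_incr : increasing2 GO;
  go_cont : continuous2 GO }.

Record grouping (R : realType)
    (G : unit_itv R -> unit_itv R -> unit_itv R) : Prop := {
  grC : forall x y, G x y = G y x;
  gr_cont : continuous2 G;
  gr_incr : increasing2 G;
  gr0 : forall x y, G x y = I0 <-> x = I0 /\ y = I0;
  gr1 : forall x y, G x y = I1 <-> x = I1 \/ y = I1 }.

Definition dual_op (R : realType) (N : unit_itv R -> unit_itv R)
    (GO : unit_itv R -> unit_itv R -> unit_itv R)
    : unit_itv R -> unit_itv R -> unit_itv R :=
  fun x y => N (GO (N x) (N y)).

Definition impl_GO_N (R : realType)
    (GO : unit_itv R -> unit_itv R -> unit_itv R)
    (N : unit_itv R -> unit_itv R) : unit_itv R -> unit_itv R -> unit_itv R :=
  fun x y => N (GO x (N y)).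

Definition impl_G_N (R : realType)
    (G : unit_itv R -> unit_itv R -> unit_itv R)
    (N : unit_itv R -> unit_itv R) : unit_itv R -> unit_itv R -> unit_itv R :=
  fun x y => G (N x) y.

(* Main.v *)
Require Import Defs.
From mathcomp Require Import all_boot all_order all_algebra.
From mathcomp Require Import all_classical all_reals all_analysis.

(** The negation [N] is injective by strictness and surjective by the
    intermediate value theorem, hence a decreasing bijection of [0, 1] that
    swaps the two end points.

    Conjugating [GO] by [N] therefore exchanges the roles of 0 and 1.  The
    hypotheses sharpen the boundary conditions of [GO] to equivalences: its
    value is 1 exactly when both arguments are 1, and 0 exactly when one of them
    is 0.  After conjugation these are the two boundary equivalences of a
    grouping function ([dual_op_grouping]).  Monotonicity survives because each
    variable passes through [N] twice, and continuity because everything is a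
    composition of continuous maps.

    The identity of implications is [N (GO x (N y)) = N (GO (N x') (N y))] with
    [x' = neg_inv N x], so it only needs [N (neg_inv N x) = x], which is where
    surjectivity enters ([unit_itv_IVT_surj], [neg_invK]). *)

Set Implicit Arguments.
Unset Strict Implicit.
Unset Printing Implicit Defensive.

Import Order.TTheory GRing.Theory Num.Theory.
Import numFieldNormedType.Exports.

Local Open Scope ring_scope.

Lemma ival_inj (R : realType) : injective (@ival R).
Proof. exact: val_inj. Qed.

Lemma ival_ge0 (R : realType) (x : unit_itv R) : 0 <= ival x.
Proof.
by have := valP x; rewrite inE /itv01 /= in_itv /= => /andP[].
Qed.

Lemma ival_le1 (R : realType) (x : unit_itv R) : ival x <= 1.
Proof.
by have := valP x; rewrite inE /itv01 /= in_itv /= => /andP[].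
Qed.

Lemma ival_mul_eq0 (R : realType) (x y : unit_itv R) :
  ival x * ival y = 0 <-> x = I0 \/ y = I0.
Proof.
split=> [/eqP|[]->]; last 2 first.
- exact: mul0r.
- exact: mulr0.
by rewrite mulf_eq0 => /orP[] /eqP h; [left|right]; apply: ival_inj.
Qed.

Lemma ival_mul_eq1 (R : realType) (x y : unit_itv R) :
  ival x * ival y = 1 <-> x = I1 /\ y = I1.
Proof.
split=> [xy1|[-> ->]]; last exact: mulr1.
have x1 : ival x = 1.
  apply/le_anti; rewrite ival_le1 /= -[leLHS]xy1.
  by apply: ler_piMr; [exact: ival_ge0 | exact: ival_le1].
split; apply: ival_inj => //.
by move: xy1; rewrite x1 mul1r.
Qed.

(** The subtype topology makes a map continuous on [0, 1] exactly when its
    extension to the line ([valL_]) is continuous within the interval, so the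
    intermediate value theorem on the line applies to that extension. *)
Lemma unit_itv_IVT_surj (R : realType) (f : unit_itv R -> unit_itv R) :
  continuous f -> f I0 = I1 -> f I1 = I0 -> forall y, exists x, f x = y.
Proof.
move=> fC f0 f1 y.
pose g : R -> R := valL_ 0 (@ival R \o f).
have gE x : g (ival x) = ival (f x).
  by have := congr1 (fun h => h x) (@valLK _ _ (0 : R) (itv01 R) (@ival R \o f)).
have gC : {within `[0, 1]%classic, continuous g}%classic.
  apply/(@subspace_valL_continuousP' _ (itv01 R) _ 0 (@ival R \o f)) => x.
  by apply: continuous_comp; [exact: fC | exact: initial_continuous].
have g0 : g 0 = 1 by have := gE I0; rewrite f0.
have g1 : g 1 = 0 by have := gE I1; rewrite f1.
have [|c c01 gc] := IVT (v := ival y) ler01 gC.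
  by rewrite g0 g1 (min_idPr ler01) (max_idPl ler01) ival_ge0 ival_le1.
have cA : c \in itv01 R by rewrite inE.
exists (SigSub cA); apply: ival_inj.
by rewrite -gE -gc.
Qed.

Lemma strict_fuzzy_negation_inj (R : realType) (N : unit_itv R -> unit_itv R) :
  strict_fuzzy_negation N -> injective N.
Proof.
move=> hN x y Nxy; apply: ival_inj.
by case: (ltgtP (ival x) (ival y)) => // /(sneg_lt hN); rewrite Nxy ltxx.
Qed.

Lemma neg_invK (R : realType) (N : unit_itv R -> unit_itv R) :
  strict_fuzzy_negation N -> cancel (neg_inv N) N.
Proof.
move=> hN x; apply: pinvK; rewrite inE.
have [y <-] := unit_itv_IVT_surj (sneg_cont hN) (fneg0 (sneg_fuzzy hN))
  (fneg1 (sneg_fuzzy hN)) x.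
by exists y.
Qed.

Lemma strict_neg_eq0 (R : realType) (N : unit_itv R -> unit_itv R) x :
  strict_fuzzy_negation N -> N x = I0 <-> x = I1.
Proof.
move=> hN; rewrite -(fneg1 (sneg_fuzzy hN)).
by split=> [/(strict_fuzzy_negation_inj hN)|->].
Qed.

Lemma strict_neg_eq1 (R : realType) (N : unit_itv R -> unit_itv R) x :
  strict_fuzzy_negation N -> N x = I1 <-> x = I0.
Proof.
move=> hN; rewrite -(fneg0 (sneg_fuzzy hN)).
by split=> [/(strict_fuzzy_negation_inj hN)|->].
Qed.

Lemma dual_op_continuous2 (R : realType) (N : unit_itv R -> unit_itv R)
    (F : unit_itv R -> unit_itv R -> unit_itv R) :
  continuous N -> continuous2 F -> continuous2 (dual_op N F).
Proof.
move=> NC FC p.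
apply: (continuous_comp (f := fun p => F (N p.1) (N p.2))); last exact: NC.
apply: continuous2_cvg; first exact: (FC (N p.1, N p.2)).
- by apply: continuous_comp; [exact: cvg_fst | exact: NC].
- by apply: continuous_comp; [exact: cvg_snd | exact: NC].
Qed.

Lemma dual_op_increasing2 (R : realType) (N : unit_itv R -> unit_itv R)
    (F : unit_itv R -> unit_itv R -> unit_itv R) :
  fuzzy_negation N -> increasing2 F -> increasing2 (dual_op N F).
Proof.
by move=> hN [Fl Fr]; split=> [x x' y xx'|x y y' yy']; apply: (fneg_anti hN);
  [apply: Fl | apply: Fr]; apply: (fneg_anti hN).
Qed.

Lemma dual_op_grouping (R : realType) (N : unit_itv R -> unit_itv R)
    (GO : unit_itv R -> unit_itv R -> unit_itv R) :
  strict_fuzzy_negation N -> general_overlap GO ->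
  (forall x y : unit_itv R, GO x y = I0 -> ival x * ival y = 0) ->
  (forall x y : unit_itv R, GO x y = I1 -> ival x * ival y = 1) ->
  grouping (dual_op N GO).
Proof.
move=> hN hGO hGO0 hGO1; split.
- by move=> x y; rewrite /dual_op (goC hGO).
- exact: dual_op_continuous2 (sneg_cont hN) (go_cont hGO).
- exact: dual_op_increasing2 (sneg_fuzzy hN) (go_incr hGO).
- move=> x y; split=> [/(strict_neg_eq0 _ hN)/hGO1/ival_mul_eq1[]|[-> ->]].
    by move=> /(strict_neg_eq1 _ hN) + /(strict_neg_eq1 _ hN).
  apply/(strict_neg_eq0 _ hN)/(go1 hGO)/ival_mul_eq1.
  by rewrite (fneg0 (sneg_fuzzy hN)).
- move=> x y; split=> [/(strict_neg_eq1 _ hN)/hGO0/ival_mul_eq0|xy1].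
    by case=> /(strict_neg_eq0 _ hN); [left|right].
  apply/(strict_neg_eq1 _ hN)/(go0 hGO)/ival_mul_eq0.
  by case: xy1 => ->; rewrite (fneg1 (sneg_fuzzy hN)); [left|right].
Qed.

Theorem proposition20 (R : realType) (N : unit_itv R -> unit_itv R)
    (GO : unit_itv R -> unit_itv R -> unit_itv R)
    (hN : strict_fuzzy_negation N) (hGO : general_overlap GO)
    (hGO0 : forall x y : unit_itv R, GO x y = I0 -> ival x * ival y = 0)
    (hGO1 : forall x y : unit_itv R, GO x y = I1 -> ival x * ival y = 1) :
  grouping (dual_op N GO) /\
  impl_GO_N GO N = impl_G_N (dual_op N GO) (neg_inv N).
Proof.
split; first exact: dual_op_grouping.
apply/funext => x; apply/funext => y.
by rewrite /impl_GO_N /impl_G_N /dual_op (neg_invK hN).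
Qed.
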